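(* For $m\ge2$, the NCCC-graph $\Gamma_{V_{8m}}$ is not hyperenergetic, and it is L-hyperenergetic and Q-hyperenergetic if and only if $m\ne 2$ (i.e. $m\ge3$).
   Context: $V_{8m}=\langle x,y\mid x^{2m}=y^4=1,\ yx=x^{-1}y^{-1},\ y^{-1}x=x^{-1}y\rangle$. The NCCC-graph $\Gamma_G$ of a finite non-abelian group $G$ with center $Z(G)$ has vertex set $\{x^G: x\in G\setminus Z(G)\}$ ($x^G$ the conjugacy class of $x$), distinct vertices $x^G,y^G$ adjacent iff $x'y'\neq y'x'$ for all $x'\in x^G,y'\in y^G$. For a simple graph $\mathcal G$ with adjacency matrix $A$, degree matrix $D$, $L=D-A$, $Q=D+A$: $E(\mathcal G)=\sum|\lambda|$ over eigenvalues of $A$; with $\Delta=2|E(\mathcal G)|/|V(\mathcal G)|$, $LE(\mathcal G)=\sum|\beta-\Delta|$ over eigenvalues of $L$, $SE(\mathcal G)=\sum|\gamma-\Delta|$ over eigenvalues of $Q$. For $N=|V(\mathcal G)|$, $E(K_N)=LE(K_N)=SE(K_N)=2(N-1)$. $\mathcal G$ is hyperenergetic (resp. L-, Q-hyperenergetic) if $E(\mathcal G)>E(K_N)$ (resp. $LE(\mathcal G)>LE(K_N)$, $SE(\mathcal G)>SE(K_N)$). *)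

(* Defs.v *)
From mathcomp Require Import all_boot all_order all_algebra all_fingroup all_solvable all_field.
Set Implicit Arguments. Unset Strict Implicit. Unset Printing Implicit Defensive.
Import GRing.Theory Num.Theory.
Local Open Scope ring_scope.

(* A simple graph is given by a vertex set V : {set T} (T a finType) and an
   adjacency relation e (only used on distinct vertices; loops are ignored).
   Vertices are indexed by 'I_#|V| through enum_val. *)

(* eigenvalues (with multiplicity) of a square complex matrix: the roots of its
   characteristic polynomial, which splits over the algebraically closed algC *)
Definition spectrum n (A : 'M[algC]_n) : seq algC :=
  sval (closed_field_poly_normal (char_poly A)).

Definition adj_mx (T : finType) (V : {set T}) (e : rel T) : 'M[algC]_#|V| :=
  \matrix_(i, j) ((i != j) && e (enum_val i) (enum_val j))%:R.

Definition deg_mx (T : finType) (V : {set T}) (e : rel T) : 'M[algC]_#|V| :=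
  \matrix_(i, j) ((i == j)%:R * \sum_k adj_mx V e i k).

Definition lap_mx (T : finType) (V : {set T}) (e : rel T) : 'M[algC]_#|V| :=
  deg_mx V e - adj_mx V e.

Definition slap_mx (T : finType) (V : {set T}) (e : rel T) : 'M[algC]_#|V| :=
  deg_mx V e + adj_mx V e.

Definition nedges (T : finType) (V : {set T}) (e : rel T) : algC :=
  (\sum_i \sum_j adj_mx V e i j) / 2.

Definition avg_deg (T : finType) (V : {set T}) (e : rel T) : algC :=
  2 * nedges V e / #|V|%:R.

Definition energy (T : finType) (V : {set T}) (e : rel T) : algC :=
  \sum_(l <- spectrum (adj_mx V e)) `|l|.

Definition lap_energy (T : finType) (V : {set T}) (e : rel T) : algC :=
  \sum_(b <- spectrum (lap_mx V e)) `|b - avg_deg V e|.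

Definition slap_energy (T : finType) (V : {set T}) (e : rel T) : algC :=
  \sum_(g <- spectrum (slap_mx V e)) `|g - avg_deg V e|.

(* E(K_N) = LE(K_N) = SE(K_N) = 2(N-1) *)
Definition complete_energy (N : nat) : algC := 2 * (N%:R - 1).

Definition hyperenergetic (T : finType) (V : {set T}) (e : rel T) : Prop :=
  complete_energy #|V| < energy V e.
Definition L_hyperenergetic (T : finType) (V : {set T}) (e : rel T) : Prop :=
  complete_energy #|V| < lap_energy V e.
Definition Q_hyperenergetic (T : finType) (V : {set T}) (e : rel T) : Prop :=
  complete_energy #|V| < slap_energy V e.

Local Open Scope group_scope.

Definition nccc_vertices (gT : finGroupType) (G : {set gT}) : {set {set gT}} :=
  [set C in classes G | [exists x in C, x \notin 'Z(G)]].

Definition nccc_adj (gT : finGroupType) : rel {set gT} :=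
  fun C D => (C != D) && [forall x in C, forall y in D, x * y != y * x].

(* Main.v *)
From HB Require Import structures.
Require Import Defs.
From mathcomp Require Import all_boot all_order all_algebra all_fingroup all_solvable all_field.
From mathcomp Require Import zify ring.
Set Implicit Arguments. Unset Strict Implicit. Unset Printing Implicit Defensive.
Import Order.TTheory GRing.Theory Num.Theory.
Local Open Scope group_scope.

(** With z = y^2, the group V_{8m} has normal form x^i z^c y^b, where z is
    central of order 2 and y inverts x up to z. Two non-central elements outside
    the abelian subgroup <x, z> have commuting conjugates exactly when their
    exponents of x have the same parity, and such an element never commutes with
    a non-central element of <x, z>. Hence the NCCC-graph is the complete
    tripartite graph K_{a,a,2m-a}, where a = 1 for odd m and a = 2 for even m.
    The adjacency, Laplacian and signless Laplacian matrices of a complete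
    multipartite graph have the form D + C K C^T, with C the incidence matrix of
    the parts and D constant on parts, so a Schur complement reduces their
    spectra to those of 3 x 3 matrices. *)

(** * A model of V_{8m} *)

(* The triple (i, c, b) stands for x^i z^c y^b with z = y^2, and m = n + 1. *)
Definition V8 (n : nat) : Type := ('I_(n.*2).+2 * bool * bool)%type.
HB.instance Definition _ n := Finite.on (V8 n).

(** Since y x = x^-1 z y, moving y past x^k leaves z^k, which is the term [b && odd k]; the term
    [b && e] records y y = z. *)
Definition V8_mul n (u v : V8 n) : V8 n :=
  let: (i, c, b) := u in let: (k, d, e) := v in
  ((if b then i - k else i + k)%R,
   c (+) d (+) (b && odd k) (+) (b && e), b (+) e).

Definition V8_inv n (u : V8 n) : V8 n :=
  let: (i, c, b) := u in ((if b then i else - i)%R, c (+) (b && ~~ odd i), b).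

(** The modulus 2n + 2 is even, so parity is a homomorphism on residues. *)
Lemma odd_ordD n (i k : 'I_(n.*2).+2) : odd (i + k)%R = odd i (+) odd k.
Proof. by rewrite /= odd_mod ?oddD //= odd_double. Qed.

Lemma odd_ordN n (i : 'I_(n.*2).+2) : odd (- i)%R = odd i.
Proof.
by have := odd_ordD i (- i)%R; rewrite subrr /=; case: (odd i); case: (odd _).
Qed.

Lemma V8_mulA n : associative (@V8_mul n).
Proof.
move=> [[i c] b] [[k d] e] [[l f] g] /=; congr (_, _, _).
- by case: b; case: e => /=; ring.
- case: b; case: e; rewrite ?odd_ordD ?odd_ordN;
    by case: (odd k); case: (odd l); case: c; case: d; case: f; case: g.
- by rewrite addbA.
Qed.

Lemma V8_mul1 n : left_id ((0%R, false, false) : V8 n) (@V8_mul n).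
Proof. by move=> [[i c] b] /=; rewrite add0r !addbF. Qed.

Lemma V8_mulV n :
  left_inverse ((0%R, false, false) : V8 n) (@V8_inv n) (@V8_mul n).
Proof.
move=> [[i c] b] /=; congr (_, _, _); last by rewrite addbb.
  by case: b; rewrite ?subrr ?addNr.
by case: b; case: c; case: odd.
Qed.

HB.instance Definition _ n := Finite_isGroup.Build (V8 n)
  (@V8_mulA n) (@V8_mul1 n) (@V8_mulV n).

Lemma V8_mulE n (i k : 'I_(n.*2).+2) (c b d e : bool) :
  ((i, c, b) : V8 n) * ((k, d, e) : V8 n) =
  ((if b then i - k else i + k)%R,
   c (+) d (+) (b && odd k) (+) (b && e), b (+) e).
Proof. by []. Qed.

Lemma V8_one n : 1 = (0%R, false, false) :> V8 n. Proof. by []. Qed.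

Lemma V8_invE n (i : 'I_(n.*2).+2) (c b : bool) :
  ((i, c, b) : V8 n)^-1 =
  ((if b then i else - i)%R, c (+) (b && ~~ odd i), b).
Proof. by []. Qed.

Lemma V8_expx n k : ((1%R, false, false) : V8 n) ^+ k = (k%:R%R, false, false).
Proof. by elim: k => [|k IHk]; rewrite ?expgS ?IHk ?V8_mulE //= mulrS. Qed.

Lemma card_V8 n : #|[set: V8 n]| = (8 * n.+1)%N.
Proof. rewrite cardsT !card_prod card_ord card_bool; lia. Qed.

Lemma V8_homg n : [set: V8 n] \homg Grp (x : y : x ^+ (2 * n.+1), y ^+ 4,
                        y * x = x^-1 * y^-1, y^-1 * x = x^-1 * y).
Proof.
pose x : V8 n := (1%R, false, false); pose y : V8 n := (0%R, false, true).
have y2 : y ^+ 2 = (0%R, true, false).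
  by rewrite /y expgS expg1 V8_mulE subr0.
have y4 : y ^+ 4 = 1 by rewrite (expgM y 2 2) y2 expgS expg1 V8_mulE addr0.
have x1 : x ^+ (2 * n.+1) = 1.
  rewrite V8_expx mul2n doubleS.
  by have -> : (n.*2.+2%:R = 0 :> 'I_(n.*2).+2)%R by exact: (@pchar_Zp n.*2.+2).
have yx : y * x = x^-1 * y^-1.
  by rewrite /x /y !V8_invE !V8_mulE addr0 sub0r /=; case: odd.
have yx' : y^-1 * x = x^-1 * y.
  by rewrite /x /y !V8_invE !V8_mulE addr0 sub0r /=; case: odd.
have genxy : <[x]> <*> <[y]> = [set: V8 n].
  apply/eqP; rewrite eqEsubset subsetT; apply/subsetP=> -[[i c] b] _.
  have -> : (i, c, b) = x ^+ i * (y ^+ 2) ^+ c * y ^+ b :> V8 n.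
    rewrite y2 V8_expx natr_Zp; case: b; case: c;
    by rewrite ?expg0 ?expg1 ?mulg1 // !V8_mulE !addr0.
  by rewrite !groupM ?groupX // mem_gen // inE cycle_id ?orbT.
by apply/existsP; exists (x, y); rewrite /= genxy x1 y4 yx yx' !eqxx.
Qed.

(** The model satisfies the relations, so its order is at most that of [G]. Conversely, evaluating
    normal forms is a morphism from the model whose image contains the generators of [G], which
    gives the other inequality. *)
Lemma V8_isog n (gT : finGroupType) (G : {group gT}) :
  G \isog Grp (x : y : x ^+ (2 * n.+1), y ^+ 4,
                       y * x = x^-1 * y^-1, y^-1 * x = x^-1 * y) ->
  [set: V8 n] \isog G.
Proof.
move=> isoG; apply/(isoGrpP _ isoG); split; last exact: V8_homg.
apply/eqP; rewrite eqn_leq dvdn_leq ?card_homg ?isoG ?V8_homg //=.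
have /existsP[[x y] /= /eqP[defG x1 y4 yx yx']] := isoGrp_hom isoG.
have yxV : y * x^-1 = x * y^-1.
  by apply: (mulgI x^-1); rewrite mulKg mulgA -yx' mulgK.
have yV : y^-1 = y ^+ 2 * y by apply/eqP; rewrite eq_invg_mul -expgSr -expgS y4.
pose z := y ^+ 2; have yy : y * y = z by rewrite /z expgS expg1.
have zz : z * z = 1 by rewrite -y4 -expgD.
have zD c d : z ^+ (c (+) d) = z ^+ c * z ^+ d.
  by case: c; case: d; rewrite ?expg0 ?expg1 ?mulg1 ?mul1g.
(* y y x = y x^-1 y^-1 = x y^-2, and y^-2 = z because z has square 1. *)
have zx : commute z x.
  rewrite /commute -yy -mulgA yx mulgA yxV -!mulgA.
  by congr (x * _); apply/eqP; rewrite -invMg eq_invg_mul yy zz.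
have zXp (c : bool) k : commute (z ^+ c) (x ^+ k).
  by apply: commuteX; apply/commute_sym/commuteX/commute_sym.
have zX (c : bool) k : commute (z ^+ c) (x ^- k) by apply: commuteV.
have zy (c : bool) : commute (z ^+ c) y.
  by apply/commute_sym/commuteX/commuteX.
(* This is the rewriting rule that the twisted term of [V8_mul] encodes. *)
have xyx k : y * x ^+ k = x ^- k * z ^+ odd k * y.
  elim: k => [|k IHk]; first by rewrite invg1 !mul1g mulg1.
  have -> : odd k.+1 = odd k (+) true by rewrite addbT.
  rewrite [in RHS]expgS expgSr mulgA IHk -(mulgA _ y) yx yV invMg zD expg1 -/z.
  by rewrite !mulgA -(mulgA (x ^- k)) (zX _ 1%N) !mulgA.
pose f (u : V8 n) :=
  let: (i, c, b) := u in x ^+ (i : nat) * z ^+ (c : bool) * y ^+ (b : bool).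
have xD (i k : 'I_(n.*2).+2) : x ^+ (i + k)%R = x ^+ i * x ^+ k.
  by rewrite -expgD /= expg_mod // -[n.*2.+2]doubleS -mul2n.
have xN (k : 'I_(n.*2).+2) : x ^+ (- k)%R = x ^- k.
  by apply/eqP; rewrite eq_sym eq_invg_mul -xD subrr.
have fM : {in [set: V8 n] &, {morph f : u v / u * v}}.
  move=> [[i c] b] [[k d] e] _ _; rewrite V8_mulE /f.
  case: b; rewrite !zD ?xD ?xN ?mulg1 -!mulgA; congr (_ * _).
    have -> : y ^+ (true (+) e) = z ^+ e * y * y ^+ e.
      by case: e; rewrite ?mulg1 ?mul1g // -mulgA yy zz.
    have ze : z ^+ (true && e) * (z ^+ e * y * y ^+ e) = y * y ^+ e.
      by rewrite !mulgA -zD addbb mul1g.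
    rewrite ze expg1 (mulgA y) xyx !mulgA zX -!mulgA; congr (_ * (_ * _)).
    by rewrite (mulgA y) -zy mulgA -zD addbC zD -!mulgA.
  by rewrite !(mulgA (x ^+ k)) -zXp -!mulgA.
have -> : G = (Morphism fM @* [set: V8 n])%G.
  apply/group_inj/eqP; rewrite eqEsubset; apply/andP; split.
    rewrite -defG gen_subG subUset !cycle_subG; apply/andP; split.
      apply/morphimP; exists (1%R, false, false); rewrite ?inE //=.
      by rewrite !mulg1 expg_mod // -[n.*2.+2]doubleS -mul2n.
    apply/morphimP; exists (0%R, false, true); rewrite ?inE //=.
    by rewrite !mul1g.
  apply/subsetP => _ /morphimP[[[i c] b] _ _ ->] /=; rewrite -defG.
  by rewrite !groupM ?groupX // mem_gen // inE cycle_id ?orbT.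
by rewrite leq_morphim.
Qed.

(** * Commutation and conjugation in the model *)

Lemma card_classes_in (gT : finGroupType) (G : {group gT}) (S : {set gT}) s :
  {in S & G, forall u g, u ^ g \in S} -> {in S, forall u, #|u ^: G| = s} ->
  (#|[set u ^: G | u in S]| * s = #|S|)%N.
Proof.
move=> SJ Ss; rewrite -[RHS]sum1_card (partition_big_imset (fun u => u ^: G)) /=.
rewrite -sum_nat_const; apply: eq_bigr => _ /imsetP[u Su ->].
rewrite sum1dep_card -(Ss u Su); apply: eq_card => v; rewrite !inE.
apply/idP/andP => [uv | [_ /eqP <-]]; last exact: class_refl.
by case/imsetP: uv => g Gg ->; rewrite SJ ?classGidl.
Qed.

(* The i such that x^i is central. *)
Definition V8_fix n : {set 'I_(n.*2).+2} :=
  [set i : 'I_(n.*2).+2 | (i + i == 0)%R && ~~ odd i].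

(** Parts 0 and 1 split the complement of <x, z> by the parity of the exponent of x; part 2 is <x,
    z>. *)
Definition V8_part n (u : V8 n) : 'I_3 :=
  if u.2 then (if odd u.1.1 then @Ordinal 3 1 isT else @Ordinal 3 0 isT)
  else @Ordinal 3 2 isT.

Lemma card_V8_slices n (X : bool -> {set 'I_(n.*2).+2}) :
  #|[set u : V8 n | u.1.1 \in X u.2]| = (#|X true| * 2 + #|X false| * 2)%N.
Proof.
have -> : [set u : V8 n | u.1.1 \in X u.2] =
  setX (setX (X true) [set: bool]) [set true] :|:
  setX (setX (X false) [set: bool]) [set false].
  by apply/setP => -[[i c] [|]]; rewrite !inE /= ?andbT ?andbF ?orbF.
rewrite cardsU !cardsX !cards1 cardsT card_bool !muln1.
rewrite (_ : _ :&: _ = set0) ?cards0 ?subn0 //.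
by apply/setP => -[[i c] [|]]; rewrite !inE /= ?andbF.
Qed.

(** In each case the x-exponents of the two products differ by the double of one residue up to sign,
    and the z-exponents agree exactly when that residue is even: the two conditions defining
    [V8_fix]. *)
Lemma V8_commE n (u v : V8 n) : (u * v == v * u) =
  (if u.2 then if v.2 then u.1.1 - v.1.1 \in V8_fix n else v.1.1 \in V8_fix n
   else v.2 ==> (u.1.1 \in V8_fix n))%R.
Proof.
move: u v => [[i c] b] [[k d] e]; rewrite !V8_mulE !xpair_eqE -subr_eq0.
case: b; case: e; rewrite !inE ?odd_ordD ?odd_ordN /= ?andbT ?addbF.
- rewrite (_ : i - k - (k - i) = (i - k) + (i - k))%R; last by ring.
  by case: (_ == _) => //; case: c; case: d; case: (odd i); case: (odd k).
- rewrite (_ : i - k - (k + i) = - (k + k))%R ?oppr_eq0; last by ring.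
  by case: (_ == _) => //; case: c; case: d; case: (odd k).
- rewrite (_ : i + k - (k - i) = i + i)%R; last by ring.
  by case: (_ == _) => //; case: c; case: d; case: (odd i).
- by rewrite (addrC i) subrr eqxx addbC eqxx.
Qed.

(** Doubling kills only 0 and n + 1 modulo 2n + 2, and n + 1 is even exactly when n is odd. *)
Lemma card_V8_fix n : #|V8_fix n| = (odd n).+1.
Proof.
have -> : V8_fix n = [set i | (val i == 0) || (odd n && (val i == n.+1))].
  apply/setP => i; rewrite !inE -val_eqE /=.
  have := ltn_ord i; move: (nat_of_ord i) => {}i lti.
  have -> : ((i + i) %% n.*2.+2 == 0)%N = (i == 0)%N || (i == n.+1).
    apply/idP/orP => [/dvdnP[q]|[] /eqP ->]; last 2 first.
    - by rewrite mod0n.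
    - by rewrite addnn doubleS modnn.
    rewrite addnn -doubleS -muln2 -(muln2 n.+1) mulnA => /eqP.
    rewrite eqn_pmul2r // => /eqP e; case: q e => [|[|q]] e; [left|right|]; lia.
  by case: eqP => [->|_] //=; case: eqP => [->|_] /=; rewrite ?negbK ?andbT ?andbF.
have lt1 : (n.+1 < n.*2.+2)%N by lia.
have -> : [set i : 'I_(n.*2).+2 | (val i == 0) || (odd n && (val i == n.+1))]
   = ord0 |: (if odd n then [set Ordinal lt1] else set0).
  by apply/setP => i; case: ifP; rewrite !inE -!val_eqE /=.
by case: ifP; rewrite cardsU1 ?cards1 ?cards0 ?inE.
Qed.

(** Translation by 1 exchanges the two parity classes. *)
Lemma card_ord_odd n b : #|[set i : 'I_(n.*2).+2 | odd i == b]| = n.+1.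
Proof.
have eq_odd : #|[set i : 'I_(n.*2).+2 | odd i == b]| =
              #|[set i : 'I_(n.*2).+2 | odd i == ~~ b]|.
  rewrite -(card_imset _ (addrI 1%R)); apply: eq_card => i; rewrite inE.
  apply/imsetP/idP => [[j /[!inE] /eqP <- ->]|/eqP ib].
    by rewrite odd_ordD.
  exists (i - 1)%R; last by rewrite addrC subrK.
  by rewrite inE odd_ordD odd_ordN ib addbT negbK.
have := cardsC [set i : 'I_(n.*2).+2 | odd i == b]; rewrite card_ord.
have -> : ~: [set i : 'I_(n.*2).+2 | odd i == b] =
  [set i : 'I_(n.*2).+2 | odd i == ~~ b].
  by apply/setP => i; rewrite !inE; case: odd; case: b {eq_odd}.
lia.
Qed.

(** Testing against x and y suffices: commuting with x forces [~~ u.2], since 1 is odd, and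
    commuting with y then puts the exponent in [V8_fix]. *)
Lemma V8_center n :
  'Z([set: V8 n]) = [set u : V8 n | ~~ u.2 && (u.1.1 \in V8_fix n)].
Proof.
apply/setP => u; rewrite [RHS]inE; apply/centerP/andP=> [[_ cu] | [u2 fu]].
  have /eqP := cu (1%R, false, false) (in_setT _).
  have /eqP := cu (0%R, false, true) (in_setT _).
  by rewrite !V8_commE /=; case: u.2 => //=; rewrite !inE => _; rewrite andbF.
split=> [|v _]; rewrite ?in_setT //.
by apply/eqP; rewrite V8_commE (negPf u2) fu implybT.
Qed.

Lemma V8_mul2 n (u v : V8 n) : (u * v).2 = u.2 (+) v.2.
Proof. by move: u v => [[i c] b] [[k d] e]. Qed.

Lemma V8_mul_odd n (u v : V8 n) : odd (u * v).1.1 = odd u.1.1 (+) odd v.1.1.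
Proof.
move: u v => [[i c] b] [[k d] e]; rewrite V8_mulE.
by case: b; rewrite odd_ordD ?odd_ordN.
Qed.

(** The part is determined by [u.2] and the parity of [u.1.1], both homomorphisms to Z/2. *)
Lemma V8_partJ n (u v : V8 n) : V8_part (u ^ v) = V8_part u.
Proof.
rewrite /V8_part conjgE !V8_mul2 !V8_mul_odd.
have := V8_mul2 v^-1 v; have := V8_mul_odd v^-1 v; rewrite mulVg V8_one /=.
move: (odd _) (odd v.1.1) (odd u.1.1) (v^-1).2 v.2 u.2.
by do 6![case].
Qed.

(** Residues in [V8_fix] are even, so two commuting elements outside <x, z> have exponents of equal
    parity; if just one lies outside, the other is central. *)
Lemma V8_nc_commE n (u v : V8 n) :
    u \notin 'Z([set: V8 n]) -> v \notin 'Z([set: V8 n]) ->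
  u * v = v * u -> V8_part u = V8_part v.
Proof.
rewrite V8_center /V8_part => nu nv /eqP; move: nu nv.
rewrite V8_commE !inE odd_ordD odd_ordN.
case: u.2 v.2 => [] [] //=; last by move=> /negPf ->.
  by move=> _ _; case: (odd u.1.1); case: (odd v.1.1); rewrite ?andbF.
by move=> _ /negPf ->.
Qed.

(** Conjugation by x^h lowers the exponent of x^i z^c y by 2h, so exponents of equal parity can be
    made equal; <x, z> is abelian already. *)
Lemma V8_part_comm n (u v : V8 n) :
  V8_part u = V8_part v -> exists w, u ^ w * v = v * u ^ w.
Proof.
move: u v => [[i c] b] [[k d] e]; rewrite /V8_part /= => uv.
have eb : e = b.
  by apply/eqP; move: uv => /(congr1 val) /=; case: b; case: e; do 2?case: odd.
case: b eb uv => -> uv; last by exists 1; apply/eqP; rewrite conjg1 V8_commE.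
have ik : odd i = odd k by move: uv => /(congr1 val) /=; do 2!case: odd.
have [h hh] : exists h : 'I_(n.*2).+2, (h + h = i - k)%R.
  exists (((i - k)%R : nat)./2)%:R%R.
  rewrite -natrD addnn halfK odd_ordD odd_ordN ik addbb subn0.
  exact: natr_Zp.
exists (h, false, false); apply/eqP.
rewrite V8_commE conjgE !V8_invE !V8_mulE.
have -> : ((- h + (i - h)) - k = 0)%R.
  have -> : (- h + (i - h) - k = i - k - (h + h))%R by ring.
  by rewrite hh subrr.
by rewrite !inE addr0.
Qed.

(** * The NCCC-graph of V_{8m} *)

Lemma nccc_verticesE (gT : finGroupType) (G : {group gT}) :
  nccc_vertices G = [set u ^: G | u in G :\: 'Z(G)].
Proof.
apply/setP => C; rewrite inE; apply/andP/imsetP => [[]|[u /setDP[Gu nu] ->]].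
  case/imsetP => v Gv -> /exists_inP[u /imsetP[g Gg ->] nu].
  by exists (v ^ g); rewrite ?classGidl // inE nu groupJ.
by rewrite mem_classes //; split=> //; apply/exists_inP; exists u; rewrite ?class_refl.
Qed.

(** This is K_{a,a,b} with colouring [c]. Only distinct vertices are constrained, in accordance with
    [adj_mx], which ignores loops. *)
Definition tripartite (T : finType) (V : {set T}) (e : rel T) (a b : nat)
    (c : T -> 'I_3) : Prop :=
  {in V &, forall C D, C != D -> e C D = (c C != c D)} /\
  forall k : 'I_3, #|[set C in V | c C == k]| = if val k == 2 then b else a.

Lemma nccc_isog (aT rT : finGroupType) (G : {group aT}) (H : {group rT}) :
  G \isog H -> exists2 h : {set aT} -> {set rT},
    {in nccc_vertices G &, injective h} /\ h @: nccc_vertices G = nccc_vertices H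
    & {in nccc_vertices G &, forall C D, nccc_adj (h C) (h D) = nccc_adj C D}.
Proof.
case/isogP => f injf defH.
have sVG C : C \in nccc_vertices G -> C \subset G.
  by rewrite nccc_verticesE => /imsetP[u /setDP[Gu _] ->]; rewrite class_subG.
exists (fun C => f @* C).
  split; first by move=> C D /sVG sC /sVG sD; apply: injm_morphim_inj.
  rewrite !nccc_verticesE -imset_comp -defH -injm_center // -morphimDG
    ?(subset_trans injf) ?sub1G //.
  rewrite [f @* (_ :\: _)]morphimEsub ?subsetDl // -imset_comp.
  apply: eq_in_imset => u.
  by case/setDP => Gu _ /=; rewrite morphim_class.
move=> C D VC VD; have sC := sVG C VC; have sD := sVG D VD.
rewrite /nccc_adj (inj_in_eq (injm_morphim_inj injf)) ?inE //; congr (_ && _).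
apply/forall_inP/forall_inP => [fCD u Cu | CD _ /morphimP[u Gu Cu ->]].
  apply/forall_inP => v Dv.
  have [Gu Gv] := (subsetP sC u Cu, subsetP sD v Dv).
  have /forall_inP/(_ (f v)) := fCD (f u) (mem_morphim f Gu Cu).
  rewrite mem_morphim // -!morphM // => /(_ isT); apply: contraNneq => -> //.
apply/forall_inP => _ /morphimP[v Gv Dv ->].
rewrite -!morphM // (inj_in_eq (injmP injf)) ?groupM //.
by have /forall_inP/(_ v Dv) := CD u Cu.
Qed.

Lemma tripartite_imset (T T' : finType) (V : {set T}) (V' : {set T'})
    (e : rel T) (e' : rel T') a b c (h : T -> T') :
  {in V &, injective h} -> h @: V = V' ->
  {in V &, forall C D, e' (h C) (h D) = e C D} ->
  tripartite V e a b c -> exists c', tripartite V' e' a b c'.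
Proof.
move=> injh <- eh [ce cV].
(* The colouring transported along the inverse of [h]; the default [ord0] is taken only outside the
   image of [V]. *)
pose c' D := if [pick C in V | h C == D] is Some C then c C else ord0.
have hc C : C \in V -> c' (h C) = c C.
  move=> VC; rewrite /c'; case: pickP => [D /andP[VD /eqP /injh -> //]|].
  by move/(_ C); rewrite VC eqxx.
exists c'; split=> [_ _ /imsetP[C VC ->] /imsetP[D VD ->] nCD|k].
  by rewrite eh // !hc // ce //; apply: contraNneq nCD => ->.
rewrite -cV -(card_in_imset (f := h) (D := [set C in V | c C == k])); last first.
  by move=> C D /setIdP[VC _] /setIdP[VD _]; apply: injh.
apply: eq_card => D; rewrite inE; apply/andP/imsetP => [[/imsetP[C VC ->]]|[C]].
  by rewrite hc // => cC; exists C; rewrite ?inE ?VC.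
by rewrite inE => /andP[VC cC] ->; rewrite hc // imset_f.
Qed.

(** By [V8_commE], the centralizer of u outside <x, z> meets each coset of <x, z> in
    [2 * #|V8_fix n|] elements, while that of a non-central u in <x, z> is <x, z> itself. *)
Lemma card_V8_cent n (u : V8 n) : u \notin 'Z([set: V8 n]) ->
  #|'C[u]| = (if u.2 then 4 * (odd n).+1 else 4 * n.+1)%N.
Proof.
rewrite V8_center inE => nu.
pose X b : {set 'I_(n.*2).+2} :=
  if u.2 then (if b then [set i | i - u.1.1 \in V8_fix n] else V8_fix n)%R
  else if b then set0 else setT.
have -> : 'C[u] = [set v : V8 n | v.1.1 \in X v.2].
  apply/setP => v; rewrite [RHS]inE.
  have -> : (v \in 'C[u]) = (v * u == u * v).
    by apply/cent1P/eqP.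
  move: nu; rewrite V8_commE /X; case: u.2; case: v.2 => /=; rewrite ?inE //.
  by move/negPf.
rewrite card_V8_slices /X; case: u.2; last first.
  rewrite cards0 cardsT card_ord; lia.
rewrite (_ : [set i | _] = [set (i + u.1.1)%R | i in V8_fix n]).
  by rewrite (card_imset _ (addIr _)) card_V8_fix; lia.
apply/setP => i; rewrite inE; apply/idP/imsetP => [fi | [j fj ->]].
  by exists (i - u.1.1)%R; rewrite ?subrK.
by rewrite addrK.
Qed.

Lemma card_class_setT (gT : finGroupType) (u : gT) :
  (#|'C[u]| * #|u ^: [set: gT]| = #|[set: gT]|)%N.
Proof. by rewrite -index_cent1 setTI Lagrange ?subsetT. Qed.

(** Adjacency comes from [V8_nc_commE] and [V8_part_comm]. Classes within a part have a common size,
    so the number of vertices is the number of non-central elements of the part divided by it. *)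
Lemma V8_tripartite n :
  tripartite (nccc_vertices [set: V8 n]) (@nccc_adj (V8 n))
    (odd n).+1 (n.*2.+2 - (odd n).+1) (fun C => V8_part (repr C)).
Proof.
have part_repr (u : V8 n) : V8_part (repr (u ^: [set: V8 n])) = V8_part u.
  have /imsetP[v _ ->] := mem_repr _ (class_refl [set: V8 n] u).
  exact: V8_partJ.
split.
  rewrite nccc_verticesE => _ _ /imsetP[u /setDP[_ nu] ->] /imsetP[v /setDP[_ nv] ->] nuv.
  rewrite /nccc_adj nuv !part_repr /=.
  apply/forall_inP/idP => [adj | npt _ /imsetP[g _ ->]].
    apply/negP => /eqP /V8_part_comm[w /eqP]; apply/negP.
    have /forall_inP := adj _ (memJ_class u (in_setT w)); apply.
    exact: class_refl.
  apply/forall_inP => _ /imsetP[h _ ->].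
  apply: contraNneq npt => /V8_nc_commE; rewrite !V8_partJ => -> //.
    by rewrite memJ_norm // (subsetP (normal_norm (center_normal _))) ?in_setT.
  by rewrite memJ_norm // (subsetP (normal_norm (center_normal _))) ?in_setT.
move=> k; set G := [set: V8 n]%G.
pose S := [set u : V8 n | (u \notin 'Z(G)) && (V8_part u == k)].
have -> : [set C in nccc_vertices G | V8_part (repr C) == k] =
          [set u ^: G | u in S].
  rewrite nccc_verticesE; apply/setP => C; rewrite inE.
  apply/andP/imsetP => [[/imsetP[u /setDP[_ nu] ->]]|[u]].
    by rewrite part_repr => ku; exists u; rewrite // inE nu.
  rewrite inE => /andP[nu ku] ->; rewrite part_repr ku; split=> //.
  by apply/imsetP; exists u; rewrite // in_setD nu in_setT.
have SJ : {in S & G, forall u g, u ^ g \in S}.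
  move=> u g; rewrite inE => /andP[nu ku] Gg; rewrite inE V8_partJ ku.
  by rewrite memJ_norm ?nu // (subsetP (normal_norm (center_normal G))).
have part2 (u : V8 n) : (val (V8_part u) == 2) = ~~ u.2.
  by rewrite /V8_part; case: u.2 => //; case: odd.
(* The class size, 8(n + 1) divided by the order of the centralizer. *)
pose s := if val k == 2 then 2 else (if odd n then n.+1 else 2 * n.+1)%N.
have Ss : {in S, forall u, #|u ^: G| = s}.
  move=> u; rewrite inE => /andP[nu /eqP ku].
  have := card_class_setT u; rewrite card_V8_cent // card_V8.
  rewrite -/G; move: #|_ ^: _| => x.
  rewrite /s -ku part2; case: u.2 => /=; last by nia.
  by case: odd; lia.
have := card_classes_in SJ Ss.
have inZ (u : V8 n) : (u \in 'Z(G)) = ~~ u.2 && (u.1.1 \in V8_fix n).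
  by have /setP/(_ u) := V8_center n; rewrite [in RHS]inE.
pose X b : {set 'I_(n.*2).+2} :=
  if b then if val k == 2 then set0 else [set i : 'I_(n.*2).+2 | odd i == (val k == 1%N)]
  else if val k == 2 then ~: V8_fix n else set0.
have cardS : #|S| = (#|X true| * 2 + #|X false| * 2)%N.
  rewrite -card_V8_slices; suff -> : S = [set u : V8 n | u.1.1 \in X u.2] by [].
  apply/setP => u; rewrite [RHS]inE inE.
  have -> : (u \in 'Z(G)) = ~~ u.2 && (u.1.1 \in V8_fix n) by exact: inZ.
  rewrite -val_eqE /X /V8_part; case: u => [[i c] b] /=.
  case: k {s SJ part2 Ss X S} => [[|[|[|k]]] ltk]; case: b; rewrite ?inE //=;
    by case: (odd i); case: (i + i == 0)%R.
rewrite cardS /X /s; move: #|[set _ | _ in S]| => p; case: ifP => _.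
  by rewrite cards0 [#|~: _|]cardsCs setCK card_ord card_V8_fix; lia.
by rewrite cards0 card_ord_odd; case: odd; nia.
Qed.

Local Open Scope ring_scope.

(** * Spectra of complete tripartite graphs *)

Lemma spectrumE n (A : 'M[algC]_n) :
  char_poly A = \prod_(z <- spectrum A) ('X - z%:P).
Proof.
rewrite /spectrum; case: closed_field_poly_normal => s /= {1}->.
by rewrite (monicP (char_poly_monic A)) scale1r.
Qed.

Lemma char_poly_diag (R : comNzRingType) n (d : 'rV[R]_n) :
  char_poly (diag_mx d) = \prod_i ('X - (d 0 i)%:P).
Proof.
rewrite char_poly_trig ?diag_mx_is_trig //.
by apply: eq_bigr => i _; rewrite mxE eqxx mulr1n.
Qed.

(* The matrix on the left is D + C K C^T, with C the 0-1 incidence matrix of f;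
   both sides are the determinant of [[X - D, C], [K C^T, 1]] times that of
   [[1, -C], [0, X - diag h]]. *)
Lemma char_poly_parts (R : comNzRingType) N p (f : 'I_N -> 'I_p)
    (h : 'rV[R]_p) (K : 'M[R]_p) :
  char_poly (\matrix_(i, j) (h 0 (f i) *+ (i == j) + K (f i) (f j)))
    * char_poly (diag_mx h) =
  char_poly (diag_mx (\row_i h 0 (f i)))
    * char_poly (diag_mx h + K *m diag_mx (\row_k \sum_i (f i == k)%:R)).
Proof.
set M := \matrix_(i, j) _; set D := diag_mx (\row_i _); set cnt := \row_k _.
pose C : 'M[{poly R}]_(N, p) := \matrix_(i, k) (f i == k)%:R.
pose KP := map_mx polyC K.
pose B := block_mx (char_poly_mx D) C (KP *m C^T) 1%:M.
have CE q (A : 'M[{poly R}]_(p, q)) i k : (C *m A) i k = A (f i) k.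
  rewrite mxE (bigD1 (f i)) //= mxE eqxx mul1r big1 ?addr0 // => j ne.
  by rewrite mxE eq_sym (negPf ne) mul0r.
have KCE k j : (KP *m C^T) k j = (K k (f j))%:P.
  rewrite mxE (bigD1 (f j)) //= !mxE eqxx mulr1 big1 ?addr0 // => l ne.
  by rewrite !mxE eq_sym (negPf ne) mulr0.
have MCK : char_poly_mx M + C *m (KP *m C^T) = char_poly_mx D.
  apply/matrixP => i j; rewrite mxE CE KCE !mxE.
  by rewrite !rmorphD /=; ring.
(* The matrix D is constant on parts, so C intertwines it with [diag_mx h]. *)
have DC : char_poly_mx D *m C = C *m char_poly_mx (diag_mx h).
  apply/matrixP => i k; rewrite CE /char_poly_mx !mxE (bigD1 i) //= big1.
    rewrite !mxE eqxx addr0 !mulr1n; case: eqP => [->|_] /=;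
      last by rewrite mulr0 !mulr0n subrr.
    by rewrite mulr1.
  by move=> j /negPf ne; rewrite !mxE eq_sym ne !mulr0n subrr mul0r.
have CTC : C^T *m C = map_mx polyC (diag_mx cnt).
  apply/matrixP => k l; rewrite !mxE rmorphMn rmorph_sum /= -sumrMnl.
  apply: eq_bigr => i _; rewrite !mxE rmorph_nat.
  by case: eqP => [->|] /=; rewrite ?mul1r ?mulrb ?mul0r ?mul0rn //; case: (k == l).
have -> : char_poly M = \det B.
  have -> : B = block_mx (char_poly_mx M) C 0 1%:M *m
                block_mx 1%:M 0 (KP *m C^T) 1%:M.
    by rewrite mulmx_block !mulmx1 ?mulmx0 ?mul0mx ?mul1mx ?add0r ?addr0 MCK.
  by rewrite det_mulmx det_ublock det_lblock !det1 !mulr1.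
have -> : char_poly (diag_mx h) =
    \det (block_mx 1%:M (- C) 0 (char_poly_mx (diag_mx h))).
  by rewrite det_ublock det1 mul1r.
(* The intertwining relation kills the upper right block, and the product of the two block matrices
   is lower triangular. *)
rewrite -det_mulmx mulmx_block !mulmx1 !mulmx0 !mulmxN DC addNr !addr0.
rewrite det_lblock; congr (_ * \det _).
rewrite -mulmxA CTC /char_poly_mx map_mxD map_mxM opprD.
by rewrite mul1mx addrC -addrA.
Qed.

(** Both sides of [char_poly_parts] split into linear factors, so their root multisets coincide; the
    extra factor [char_poly (diag_mx h)] accounts for the subtracted sum. *)
Lemma sum_spectrum_parts N p (f : 'I_N -> 'I_p) (h : 'rV[algC]_p)
    (K : 'M[algC]_p) (s : seq algC) (F : algC -> algC) :
  char_poly (diag_mx h + K *m diag_mx (\row_k \sum_i (f i == k)%:R)) =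
    \prod_(z <- s) ('X - z%:P) ->
  \sum_(z <- spectrum (\matrix_(i, j) (h 0 (f i) *+ (i == j) + K (f i) (f j)))) F z
    = \sum_i F (h 0 (f i)) + \sum_(z <- s) F z - \sum_k F (h 0 k).
Proof.
move=> def_s; have := char_poly_parts f h K.
set M := \matrix_(i, j) _; rewrite def_s spectrumE !char_poly_diag.
have prodE n (g : 'I_n -> algC) : \prod_i ('X - (g i)%:P) =
    \prod_(z <- [seq g i | i <- enum 'I_n]) ('X - z%:P).
  by rewrite big_map big_enum.
have sumE n (g : 'I_n -> algC) :
    \sum_i F (g i) = \sum_(z <- [seq g i | i <- enum 'I_n]) F z.
  by rewrite big_map big_enum.
rewrite (eq_bigr (fun i => 'X - (h 0 (f i))%:P)) => [|i _]; last by rewrite mxE.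
rewrite !prodE -!big_cat /= => /prod_XsubC_eq eq_s.
by rewrite !sumE -big_cat /= -(perm_big _ eq_s) big_cat addrK.
Qed.

(** The vector (1, -1, 0) has eigenvalue h1 - g a. On vectors equal in the first two coordinates the
    matrix acts as a 2 x 2 matrix, whose trace and determinant are the prescribed sum and
    product. *)
Lemma char_poly3 (R : comNzRingType) (a b h1 h2 g l1 l2 : R)
    (A := \matrix_(i < 3, j < 3)
      ((if val i == 2 then h2 else h1) *+ (i == j) +
       g * (i != j)%:R * (if val j == 2 then b else a))) :
  l1 + l2 = h1 + g * a + h2 ->
  l1 * l2 = (h1 + g * a) * h2 - 2 * g ^+ 2 * a * b ->
  char_poly A = \prod_(z <- [:: h1 - g * a; l1; l2]) ('X - z%:P).
Proof.
move=> eqD eqM; rewrite !big_cons big_nil mulr1.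
rewrite /char_poly (expand_det_row _ ord0) !big_ord_recl big_ord0 /cofactor.
rewrite !(expand_det_row _ ord0) !big_ord_recl !big_ord0 /cofactor !det_mx11.
rewrite !mxE /=.
rewrite /bump /= !(mulr0, mulr1, mul0r, addr0, add0r, mulr0n, mulr1n, sub0r).
have -> : ('X - l1%:P) * ('X - l2%:P) =
  'X * 'X - (l1 + l2)%:P * 'X + (l1 * l2)%:P :> {poly R} by ring.
rewrite eqD eqM; ring.
Qed.

(** * Energies of K_{a,a,b} *)

Section TripartiteEnergy.
Variables (T : finType) (V : {set T}) (e : rel T) (a b : nat) (c : T -> 'I_3).
Hypothesis tri : tripartite V e a b c.
Local Notation cv i := (c (enum_val (i : 'I_#|V|))).

Lemma tripartite_sum (F : 'I_3 -> algC) :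
  \sum_(i < #|V|) F (cv i) =
  F (@Ordinal 3 0 isT) *+ a + F (@Ordinal 3 1 isT) *+ a + F (@Ordinal 3 2 isT) *+ b.
Proof.
rewrite -(big_enum_val (fun x => F (c x))) /=.
rewrite (partition_big c xpredT) //= !big_ord_recl big_ord0 addr0 addrA.
have FE k : \sum_(x in V | c x == k) F (c x) = F k *+ (if val k == 2 then b else a).
  rewrite -tri.2 -sumr_const; apply: eq_big => [x|x /andP[_ /eqP ->] //].
  by rewrite !inE.
by rewrite !FE /=; congr (F _ *+ _ + F _ *+ _ + F _ *+ _); apply: val_inj.
Qed.

Lemma tripartite_card : #|V|%:R = 2 * a%:R + b%:R :> algC.
Proof.
have := tripartite_sum (fun => 1); rewrite sumr_const card_ord => ->; ring.
Qed.

Lemma tripartite_adj i j : adj_mx V e i j = (cv i != cv j)%:R.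
Proof.
rewrite mxE; case: (altP (i =P j)) => [->|nij]; first by rewrite eqxx.
by rewrite tri.1 ?enum_valP // (inj_eq enum_val_inj).
Qed.

Definition tripartite_deg (k : 'I_3) : algC :=
  if val k == 2 then 2 * a%:R else a%:R + b%:R.

Lemma tripartite_degE i : \sum_j adj_mx V e i j = tripartite_deg (cv i).
Proof.
rewrite (eq_bigr _ (fun j _ => tripartite_adj i j)).
rewrite (tripartite_sum (fun k => (cv i != k)%:R)) /tripartite_deg.
by case: (cv i) => [[|[|[|k]]] ltk] //=; rewrite -?val_eqE /=; ring.
Qed.

(** Multiplying by the number of vertices lets the identity cover the empty graph, where both sides
    vanish. *)
Lemma tripartite_avg_deg : avg_deg V e * (2 * a%:R + b%:R) =
  2 * a%:R ^+ 2 + 4 * a%:R * b%:R :> algC.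
Proof.
case: (eqVneq (2 * a%:R + b%:R : algC) 0) => [N0|N0].
  have : (2 * a + b)%:R = 0 :> algC by rewrite natrD natrM.
  move/eqP; rewrite pnatr_eq0 addn_eq0 muln_eq0 => /andP[/eqP -> /eqP ->].
  ring.
rewrite /avg_deg /nedges tripartite_card (eq_bigr _ (fun i _ => tripartite_degE i)).
by rewrite tripartite_sum /tripartite_deg /=; field.
Qed.

(** One formula serves three matrices: (h1, h2, g) is (0, 0, 1) for adjacency, and (a + b, 2a, -1)
    or (a + b, 2a, 1) for the Laplacian or signless Laplacian. *)
Lemma tripartite_spectrum (h1 h2 g l1 l2 : algC) (F : algC -> algC) M :
  M = \matrix_(i < #|V|, j < #|V|) ((if val (cv i) == 2 then h2 else h1) *+ (i == j)
       + g * (cv i != cv j)%:R) ->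
  l1 + l2 = h1 + g * a%:R + h2 ->
  l1 * l2 = (h1 + g * a%:R) * h2 - 2 * g ^+ 2 * a%:R * b%:R ->
  \sum_(z <- spectrum M) F z =
    2 * (a%:R - 1) * F h1 + (b%:R - 1) * F h2 + F (h1 - g * a%:R) + F l1 + F l2.
Proof.
move=> -> eqD eqM.
pose h : 'rV[algC]_3 := \row_k if val k == 2 then h2 else h1.
pose K : 'M[algC]_3 := \matrix_(k, l) (g * (k != l)%:R).
rewrite (_ : \matrix_(i, j) _ =
  \matrix_(i, j) (h 0 (cv i) *+ (i == j) + K (cv i) (cv j))); last first.
  by apply/matrixP => i j; rewrite !mxE.
rewrite (@sum_spectrum_parts _ _ _ _ _ [:: h1 - g * a%:R; l1; l2]).
  rewrite (tripartite_sum (fun k => F (h 0 k))) !big_cons big_nil.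
  rewrite !big_ord_recl big_ord0 !mxE /=; ring.
rewrite -(char_poly3 eqD eqM); congr char_poly; apply/matrixP => k l.
rewrite mxE mul_mx_diag !mxE; congr (_ + _ * _).
rewrite (tripartite_sum (fun k => (k == l)%:R)).
by case: l => [[|[|[|l]]] ltl] //=; rewrite -?val_eqE /=; ring.
Qed.


Local Notation A := (a%:R : algC).
Local Notation B := (b%:R : algC).
Local Notation N := (2 * A + B).
Local Notation Delta := (avg_deg V e).

Lemma tripartite_energyE (l1 l2 : algC) :
  l1 + l2 = A -> l1 * l2 = - (2 * A * B) ->
  energy V e = A + `|l1| + `|l2|.
Proof.
move=> eqD eqM; rewrite /energy (@tripartite_spectrum 0 0 1 l1 l2).
- by rewrite normr0 !mulr0 !add0r mul1r normrN normr_nat.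
- by apply/matrixP => i j; rewrite tripartite_adj mxE if_same mul0rn add0r mul1r.
- by rewrite eqD; ring.
- by rewrite eqM; ring.
Qed.

(** Here g = -1: the quadratic factor has roots 0 and [N], and h1 - g a equals [N] too, hence the
    repeated term. *)
Lemma tripartite_lap_energyE :
  lap_energy V e = 2 * (A - 1) * `|A + B - Delta| + (B - 1) * `|2 * A - Delta|
    + `|N - Delta| + `|Delta| + `|N - Delta|.
Proof.
rewrite /lap_energy.
rewrite (@tripartite_spectrum (A + B) (2 * A) (-1) 0 N (fun z => `|z - Delta|)).
- by rewrite sub0r normrN (_ : A + B - -1 * A = N) //; ring.
- apply/matrixP => i j; rewrite [RHS]mxE mxE [deg_mx _ _ _ _]mxE.
  rewrite [(- adj_mx V e)%R i j]mxE.
  by rewrite tripartite_degE tripartite_adj mulr_natl mulN1r.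
- ring.
- ring.
Qed.

Lemma tripartite_slap_energyE (l1 l2 : algC) :
  l1 + l2 = 4 * A + B -> l1 * l2 = 4 * A ^+ 2 ->
  slap_energy V e = 2 * (A - 1) * `|A + B - Delta| + (B - 1) * `|2 * A - Delta|
    + `|B - Delta| + `|l1 - Delta| + `|l2 - Delta|.
Proof.
move=> eqD eqM; rewrite /slap_energy.
rewrite (@tripartite_spectrum (A + B) (2 * A) 1 l1 l2 (fun z => `|z - Delta|)).
- by rewrite (_ : A + B - 1 * A = B) //; ring.
- apply/matrixP => i j; rewrite [RHS]mxE mxE [deg_mx _ _ _ _]mxE.
  by rewrite tripartite_degE tripartite_adj mulr_natl mul1r.
- by rewrite eqD; ring.
- by rewrite eqM; ring.
Qed.

Hypotheses (a_gt0 : (0 < a)%N) (b_gt0 : (0 < b)%N).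

Lemma tripartite_N_gt0 : 0 < N.
Proof. by rewrite -natrM -natrD ltr0n; lia. Qed.

(** The two remaining eigenvalues are (a + s)/2 and (a - s)/2 with s^2 = a^2 + 8ab, so the energy is
    at most 2a + s. The hypothesis is the square of s <= 2(a + b - 1), which is what this bound
    requires. *)
Lemma tripartite_energy_le :
  (a ^ 2 + 8 * (a * b) <= (2 * (a + b).-1) ^ 2)%N ->
  energy V e <= complete_energy #|V|.
Proof.
move=> le_ab; pose s := sqrtC (A ^+ 2 + 8 * (A * B)).
have s2 : s ^+ 2 = A ^+ 2 + 8 * (A * B) by rewrite sqrtCK.
have s_ge0 : 0 <= s by rewrite sqrtC_ge0 -!(natrM, natrX, natrD) ler0n.
have le_s : s <= 2 * (A + B - 1).
  have -> : A + B - 1 = (a + b).-1%:R by rewrite -natrD -subn1 natrB //; lia.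
  rewrite -(@ler_pXn2r _ 2) ?nnegrE // -?natrM ?ler0n // s2.
  by rewrite -!(natrM, natrX, natrD) ler_nat.
rewrite (@tripartite_energyE ((A + s) / 2) ((A - s) / 2)); [|by field|].
  apply: (@le_trans _ _ (A + (A + s) / 2 + (A + s) / 2)).
    rewrite !normrM !(ger0_norm (_ : 0 <= 2^-1)) ?invr_ge0 ?ler0n //.
    rewrite -!addrA lerD2l lerD // ler_pM2r ?invr_gt0 ?ltr0n //.
      by rewrite ger0_norm // addr_ge0 ?ler0n.
    by rewrite (le_trans (ler_normB _ _)) // normr_nat ger0_norm.
  rewrite /complete_energy tripartite_card.
  have -> : A + (A + s) / 2 + (A + s) / 2 = 2 * A + s by field.
  have -> : 2 * (2 * A + B - 1) = 2 * A + 2 * (A + B - 1) by ring.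
  by rewrite lerD2l.
have -> : (A + s) / 2 * ((A - s) / 2) = (A ^+ 2 - s ^+ 2) / 4 by field.
by rewrite s2; field.
Qed.

Lemma tripartite_avg_degE : Delta = (2 * A ^+ 2 + 4 * A * B) / N.
Proof.
by rewrite -tripartite_avg_deg mulfK ?lt0r_neq0 ?tripartite_N_gt0.
Qed.

Lemma tripartite_Delta_real : Delta \is Num.real.
Proof.
rewrite tripartite_avg_degE ger0_real // -!(natrX, natrM, natrD).
by rewrite divr_ge0 ?ler0n.
Qed.

(** Each absolute value is bounded below by its argument or the opposite, with the sign that is
    correct when a <= b; the factor [N] clears the denominator of [Delta]. *)
Lemma tripartite_lap_energy_ge :
  2 * (A - 1) * (B * (B - A)) + (B - 1) * (2 * A * (B - A))
    + 2 * (2 * A ^+ 2 + B ^+ 2) + (2 * A ^+ 2 + 4 * A * B)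
  <= lap_energy V e * N.
Proof.
have DR := tripartite_Delta_real; have N_gt0 := tripartite_N_gt0.
have -> : 2 * (A - 1) * (B * (B - A)) + (B - 1) * (2 * A * (B - A))
    + 2 * (2 * A ^+ 2 + B ^+ 2) + (2 * A ^+ 2 + 4 * A * B) =
  (2 * (A - 1) * (A + B - Delta) + (B - 1) * (Delta - 2 * A)
    + (N - Delta) + Delta + (N - Delta)) * N.
  by rewrite tripartite_avg_degE; field; rewrite lt0r_neq0.
rewrite ler_pM2r // tripartite_lap_energyE (distrC (2 * A)).
have A1 : 0 <= A - 1 by rewrite subr_ge0 ler1n.
have B1 : 0 <= B - 1 by rewrite subr_ge0 ler1n.
rewrite !lerD ?ler_wpM2l ?mulr_ge0 ?ler0n // real_ler_norm //.
all: by rewrite rpredB // -?natrM -?natrD realn.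
Qed.

(* The two roots l1, l2 of the quadratic factor contribute at least |l1 - l2|,
   which is at least N. *)
Lemma tripartite_slap_energy_ge : (a <= b)%N ->
  2 * (A - 1) * (B * (B - A)) + (B - 1) * (2 * A * (B - A))
    + (B ^+ 2 - 2 * A * B - 2 * A ^+ 2) + N ^+ 2
  <= slap_energy V e * N.
Proof.
move=> le_ab; pose s := sqrtC (B ^+ 2 + 8 * (A * B)).
have s2 : s ^+ 2 = B ^+ 2 + 8 * (A * B) by rewrite sqrtCK.
have s_ge0 : 0 <= s by rewrite sqrtC_ge0 -!(natrM, natrX, natrD) ler0n.
have DR := tripartite_Delta_real; have N_gt0 := tripartite_N_gt0.
(* The difference s^2 - N^2 is 4a(b - a). *)
have le_s : N <= s.
  rewrite -(@ler_pXn2r _ 2) ?nnegrE ?(ltW N_gt0) // s2.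
  rewrite -!(natrM, natrX, natrD) ler_nat; nia.
have -> : 2 * (A - 1) * (B * (B - A)) + (B - 1) * (2 * A * (B - A))
    + (B ^+ 2 - 2 * A * B - 2 * A ^+ 2) + N ^+ 2 =
  (2 * (A - 1) * (A + B - Delta) + (B - 1) * (Delta - 2 * A)
    + (B - Delta) + N) * N.
  by rewrite tripartite_avg_degE; field; rewrite lt0r_neq0.
rewrite ler_pM2r // (@tripartite_slap_energyE ((4 * A + B + s) / 2)
  ((4 * A + B - s) / 2)); [|by field|]; last first.
  have -> : (4 * A + B + s) / 2 * ((4 * A + B - s) / 2) =
    ((4 * A + B) ^+ 2 - s ^+ 2) / 4 by field.
  by rewrite s2; field.
have A1 : 0 <= A - 1 by rewrite subr_ge0 ler1n.
have B1 : 0 <= B - 1 by rewrite subr_ge0 ler1n.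
have le_N : N <= `|(4 * A + B + s) / 2 - Delta| + `|(4 * A + B - s) / 2 - Delta|.
  rewrite (le_trans le_s) // -{1}(ger0_norm s_ge0) [X in _ + X]distrC.
  apply: le_trans (ler_normD _ _).
  by rewrite le_eqVlt; apply/orP; left; apply/eqP; congr `|_|; field.
rewrite (distrC (2 * A)) -(addrA _ `|_| `|_|) (lerD _ le_N) //.
rewrite !lerD ?ler_wpM2l ?mulr_ge0 ?ler0n // real_ler_norm //.
all: by rewrite rpredB // -?natrM -?natrD realn.
Qed.

End TripartiteEnergy.

(** * Comparison with the complete graph *)

Lemma lap_energies_K222 (T : finType) (V : {set T}) (e : rel T) c :
  tripartite V e 2 2 c -> lap_energy V e = 8 /\ slap_energy V e = 8.
Proof.
move=> tri; rewrite (tripartite_lap_energyE tri).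
(* For a = b = 2 the signless quadratic has sum 10 and product 16, hence roots 8 and 2. *)
rewrite (@tripartite_slap_energyE _ _ _ _ _ _ tri 8 2); try ring.
have -> : avg_deg V e = 4 by rewrite (tripartite_avg_degE tri) //; field.
have -> : (2 + 2 - 4 = 0 :> algC) by ring.
have -> : (2 * 2 - 4 = 0 :> algC) by ring.
have -> : (2 * 2 + 2 - 4 = 2 :> algC) by ring.
have -> : (8 - 4 = 4 :> algC) by ring.
have -> : (2 - 4 = - 2 :> algC) by ring.
rewrite normrN normr0 !normr_nat; split; ring.
Qed.

(** Writing the excess of each lower bound as [p.+1] or [q.+1] turns a strict inequality into a
    polynomial identity. *)
Lemma tripartite_LQ_hyperenergetic (T : finType) (V : {set T}) (e : rel T) a b c
    (p q : nat) :
  tripartite V e a b c -> (0 < a <= b)%N ->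
  (2 * (a%:R - 1) * (b%:R * (b%:R - a%:R)) + (b%:R - 1) * (2 * a%:R * (b%:R - a%:R))
    + 2 * (2 * a%:R ^+ 2 + b%:R ^+ 2) + (2 * a%:R ^+ 2 + 4 * a%:R * b%:R)
   = 2 * (2 * a%:R + b%:R - 1) * (2 * a%:R + b%:R) + p.+1%:R :> algC) ->
  (2 * (a%:R - 1) * (b%:R * (b%:R - a%:R)) + (b%:R - 1) * (2 * a%:R * (b%:R - a%:R))
    + (b%:R ^+ 2 - 2 * a%:R * b%:R - 2 * a%:R ^+ 2) + (2 * a%:R + b%:R) ^+ 2
   = 2 * (2 * a%:R + b%:R - 1) * (2 * a%:R + b%:R) + q.+1%:R :> algC) ->
  L_hyperenergetic V e /\ Q_hyperenergetic V e.
Proof.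
move=> tri /andP[a_gt0 le_ab] eqL eqQ.
have b_gt0 := leq_trans a_gt0 le_ab.
have N_gt0 := tripartite_N_gt0 a_gt0 b_gt0.
rewrite /L_hyperenergetic /Q_hyperenergetic /complete_energy (tripartite_card tri).
split; rewrite -(ltr_pM2r N_gt0).
  apply: lt_le_trans (tripartite_lap_energy_ge tri a_gt0 b_gt0).
  by rewrite eqL ltrDl ltr0n.
apply: lt_le_trans (tripartite_slap_energy_ge tri a_gt0 b_gt0 le_ab).
by rewrite eqQ ltrDl ltr0n.
Qed.

Lemma tripartite_V8_hyperenergetic (T : finType) (V : {set T}) (e : rel T) n c :
  (0 < n)%N -> tripartite V e (odd n).+1 (n.*2.+2 - (odd n).+1) c ->
  ~ hyperenergetic V e /\
  (L_hyperenergetic V e <-> n <> 1%N) /\ (Q_hyperenergetic V e <-> n <> 1%N).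
Proof.
move=> n_gt0 tri; split.
  (* For odd n the condition is 16b <= 4b^2 + 8b with b = 2n, an equality at n = 1; for even n it is
     1 + 8b <= 4b^2 with b = 2n + 1. *)
  apply/negP; rewrite le_gtF // (tripartite_energy_le tri) //;
  move: tri => _; case: odd (odd_double_half n) => /= nE; nia.
have [n1 | n1] := eqVneq n 1%N.
  (* For m = 2 the graph is K_{2,2,2}: both energies are 8, against 10 for K_6. *)
  rewrite n1 in tri *; have {}tri : tripartite V e 2 2 c := tri.
  have [L Q] := lap_energies_K222 tri.
  have le10 : (8 < complete_energy #|V|) = true.
    rewrite /complete_energy (tripartite_card tri) -subr_gt0.
    by rewrite (_ : _ - _ = 2); [rewrite ltr0n | ring].
  rewrite /L_hyperenergetic /Q_hyperenergetic L Q.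
  by rewrite (lt_gtF le10).
suff [LV QV] : L_hyperenergetic V e /\ Q_hyperenergetic V e.
  by split; split=> // _ /eqP; rewrite (negPf n1).
have n_gt1 : (1 < n)%N by lia.
case: (boolP (odd n)) tri => [odd_n | even_n].
  (* An odd n > 1 is at least 3, so b = 2n >= 6; in k = b - 6 the excesses have natural
     coefficients. *)
  have -> : (n.*2.+2 - true.+1 = (n.*2 - 6) + 6)%N by lia.
  move: (n.*2 - 6)%N => k tri; have {}tri : tripartite V e 2 (k + 6) c := tri.
  apply: (tripartite_LQ_hyperenergetic
    (p := 6 * k ^ 2 + 50 * k + 91) (q := 6 * k ^ 2 + 46 * k + 51) tri);
    [lia | ring | ring].
(* Now n >= 2 gives b = 2n + 1 >= 5, hence the shift k = b - 5. *)
have -> : (n.*2.+2 - false.+1 = (n.*2 - 4) + 5)%N by lia.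
move: (n.*2 - 4)%N => k tri; have {}tri : tripartite V e 1 (k + 5) c := tri.
apply: (tripartite_LQ_hyperenergetic
  (p := 2 * k ^ 2 + 14 * k + 23) (q := 2 * k ^ 2 + 12 * k + 9) tri);
  [lia | ring | ring].
Qed.

Local Open Scope group_scope.

(* V_{8m} = < x, y | x^{2m} = y^4 = 1, yx = x^{-1}y^{-1}, y^{-1}x = x^{-1}y > *)
Theorem theorem4p5 (m : nat) (gT : finGroupType) (G : {group gT}) :
  (2 <= m)%N ->
  G \isog Grp (x : y : x ^+ (2 * m), y ^+ 4, y * x = x^-1 * y^-1,
                        y^-1 * x = x^-1 * y) ->
  ~ hyperenergetic (nccc_vertices G) (@nccc_adj gT) /\
  (L_hyperenergetic (nccc_vertices G) (@nccc_adj gT) <-> m <> 2%N) /\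
  (Q_hyperenergetic (nccc_vertices G) (@nccc_adj gT) <-> m <> 2%N).
Proof.
case: m => // n n_gt0 isoG.
have [h [injh defV] adjh] := nccc_isog (V8_isog isoG).
have [c tri] := tripartite_imset injh defV adjh (V8_tripartite n).
have [E [L Q]] := tripartite_V8_hyperenergetic n_gt0 tri.
have -> : n.+1 <> 2%N <-> n <> 1%N.
  by split=> ne; [move=> n1 | case=> n1]; apply: ne; rewrite n1.
by [].
Qed.
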